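(* For each of the series $P_l=A_l$ ($l\ge1$), $P_l=B_l$ ($l\ge2$), $P_l=D_l$ ($l\ge4$), let $s_l$ denote the smallest root of $f_{P_l}(t)$ (all roots of $f_{P_l}$ are real, simple and lie in $(0,1)$). Then the sequence $(s_l)_l$ is monotonically decreasing and converges to $0$ as $l\to\infty$.
   Context: The polynomials are the $f$-polynomials of the cluster complexes (the generating functions $\sum_i c_i(-t)^i$, $c_i$ = number of $i$-vertex faces of the Fomin–Zelevinsky cluster complex). Explicitly: $f_{A_l}(t)=\sum_{k=0}^l(-1)^k\frac{1}{l+2}\binom{l}{k}\binom{l+k+2}{k+1}t^k$, $f_{B_l}(t)=\sum_{k=0}^l(-1)^k\binom{l}{k}\binom{l+k}{k}t^k$, $f_{D_l}(t)=\sum_{k=0}^l(-1)^k\big(\binom{l}{k}\binom{l+k-1}{k}+\binom{l-2}{k-2}\binom{l+k-2}{k}\big)t^k$, with $\binom{n}{m}=0$ for $m<0$. *)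

(* Defs.v *)
From HB Require Import structures.
From mathcomp Require Import all_boot all_order all_algebra.
From mathcomp Require Import all_classical all_reals all_analysis.
From mathcomp Require Import complex.
Set Implicit Arguments.
Unset Strict Implicit.
Unset Printing Implicit Defensive.
Import Order.TTheory GRing.Theory Num.Theory.
Import numFieldNormedType.Exports.
Local Open Scope ring_scope.

Inductive series_type := SeriesA | SeriesB | SeriesD.

Definition min_rank (P : series_type) : nat :=
  match P with SeriesA => 1%N | SeriesB => 2%N | SeriesD => 4%N end.

Definition fA (R : fieldType) (l : nat) : {poly R} :=
  \poly_(k < l.+1)
    ((-1) ^+ k * (1 / (l + 2)%:R) * 'C(l, k)%:R * 'C(l + k + 2, k + 1)%:R).

Definition fB (R : fieldType) (l : nat) : {poly R} :=
  \poly_(k < l.+1) ((-1) ^+ k * 'C(l, k)%:R * 'C(l + k, k)%:R).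

(* Since subtraction on nat is truncated, the convention binom(l-2, k-2) = 0
   for k < 2 has to be made explicit. *)
Definition fD (R : fieldType) (l : nat) : {poly R} :=
  \poly_(k < l.+1)
    ((-1) ^+ k *
       ('C(l, k)%:R * 'C(l + k - 1, k)%:R
        + (if (k < 2)%N then 0 else 'C(l - 2, k - 2)%:R)
          * 'C(l + k - 2, k)%:R)).

Definition fpoly (R : fieldType) (P : series_type) (l : nat) : {poly R} :=
  match P with SeriesA => fA R l | SeriesB => fB R l | SeriesD => fD R l end.

Definition simple_root (F : fieldType) (p : {poly F}) (z : F) : Prop :=
  root p z /\ mup z p = 1%N.

(* The roots range over the complex numbers R[i]. *)
Definition roots_real_simple_in01 (R : realType) (p : {poly R}) : Prop :=
  let pC := map_poly (real_complex R) p in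
  forall z : R[i], root pC z ->
    simple_root pC z /\ exists x : R, z = real_complex R x /\ 0 < x < 1.

Definition smallest_root (R : realType) (p : {poly R}) (x : R) : Prop :=
  root p x /\ forall y : R, root p y -> x <= y.

(* Main.v *)
(* With x = 1 - 2 t, the polynomials of types A (a = 3) and B (a = 1) satisfy
     (n + a) F_{n+1} = (2 n + a) x F_n - n F_{n-1},
   with value 1 at t = 0 and (-1)^n at t = 1, so consecutive ones have n and
   n + 1 real zeros in (0, 1) that interlace. In type D,
     2 l D_l = (3 l - 2) x B_{l-1} - (l - 2) B_{l-2},
   so the zeros of D_l interlace those of B_{l-1} in the same way. At the smallest
   zero of D_l these relations force D_{l+1} < 0, whence monotonicity. If the
   smallest zeros of F_n were all larger than some t > 0, the ratios
   F_{n+1}(t) / F_n(t) would stay positive although they eventually decrease by at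
   least 1 - x at each step; hence the convergence to 0. *)
Require Import Defs.
From HB Require Import structures.
From mathcomp Require Import all_boot all_order all_algebra.
From mathcomp Require Import all_classical all_reals all_analysis.
From mathcomp Require Import polyrcf complex ring lra zify.
Set Implicit Arguments.
Unset Strict Implicit.
Import Order.TTheory GRing.Theory Num.Theory.
Import numFieldNormedType.Exports.
Local Open Scope classical_set_scope.
Local Open Scope ring_scope.

(** * Binomial identities with subtraction taken in the ring *)

Lemma natr_bin_left (R : nzRingType) (n k : nat) :
  k.+1%:R * 'C(n, k.+1)%:R = (n%:R - k%:R) * 'C(n, k)%:R :> R.
Proof.
have [le_kn | lt_nk] := leqP k n.
  by rewrite -natrB // -!natrM mul_bin_left.
by rewrite !bin_small ?mulr0 // ltnW.
Qed.

Lemma natr_bin_down (R : nzRingType) (n k : nat) :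
  (n.+1%:R - k%:R) * 'C(n.+1, k)%:R = n.+1%:R * 'C(n, k)%:R :> R.
Proof.
have [le_kn | lt_nk] := leqP k n.+1.
  by rewrite -natrB // -!natrM -mul_bin_down.
by rewrite !bin_small ?mulr0 // ltnW.
Qed.

Lemma natr_bin_diag (R : nzRingType) (n k : nat) :
  k.+1%:R * 'C(n.+1, k.+1)%:R = n.+1%:R * 'C(n, k)%:R :> R.
Proof. by rewrite -!natrM -mul_bin_diag. Qed.

(** Removes the bound [k <= l], so that relations between coefficients can be checked for every [k]
    at once. *)
Lemma coef_poly_bin (R : nzRingType) (E : nat -> R) (l k : nat) :
  ((l < k)%N -> E k = 0) -> (\poly_(i < l.+1) E i)`_k = E k.
Proof. by move=> E0; rewrite coef_poly ltnS; case: leqP => // /E0. Qed.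

(** * The three-term recurrence from the coefficient relations *)

(* The relations on the coefficients are those of 2F1(-n, n + a; b; t),
   b = (a + 1) / 2. *)
Section GegenbauerCoefficients.

Variables (R : realFieldType) (p : nat -> {poly R}) (a b : R).
Hypotheses (a_gt0 : 0 < a) (aE : a = 2 * b - 1).
Hypothesis p_at0 : forall n, (p n)`_0 = 1.
Hypothesis coefS : forall n k,
  (k%:R + 1) * (k%:R + b) * (p n)`_k.+1
  = - (n%:R - k%:R) * (n%:R + a + k%:R) * (p n)`_k.
Hypothesis rankS : forall n k,
  (n%:R + 1 - k%:R) * (n%:R + a) * (p n.+1)`_k
  = (n%:R + 1) * (n%:R + a + k%:R) * (p n)`_k.

(** The factor n + 1 - k produced by [coefS] at [n.+1] is the one [rankS] absorbs, so it is never
    divided by, although it vanishes at k = n + 1. *)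
Lemma coef_rankS n k :
  (n%:R + a) * ((k%:R + 1) * (k%:R + b) * (p n.+1)`_k.+1)
  = - (n%:R + 1) * (n%:R + 1 + a + k%:R) * (n%:R + a + k%:R) * (p n)`_k.
Proof.
rewrite coefS -[n.+1]addn1 natrD.
have := rankS n k; rewrite addn1.
set u := (p n.+1)`_k; set v := (p n)`_k => E.
transitivity (- (n%:R + 1 + a + k%:R) * ((n%:R + 1 - k%:R) * (n%:R + a) * u)).
  by ring.
by rewrite E; ring.
Qed.

Lemma coef_rank_pred n k :
  (n%:R + 1) * ((k%:R + 1) * (k%:R + b) * (p n)`_k.+1)
  = - (n%:R - k%:R) * (n%:R + 1 - k%:R) * (n%:R + a) * (p n.+1)`_k.
Proof.
rewrite coefS; have := rankS n k.
set u := (p n.+1)`_k; set v := (p n)`_k => E.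
transitivity (- (n%:R - k%:R) * ((n%:R + 1) * (n%:R + a + k%:R) * v)).
  by ring.
by rewrite -E; ring.
Qed.

Lemma gegenbauer_rec n :
  (n.+1%:R + a) *: p n.+2
  = (2 * n.+1%:R + a) *: ((1 - 2 *: 'X) * p n.+1) - n.+1%:R *: p n.
Proof.
have nat_ge0 (m : nat) : 0 <= m%:R :> R by exact: ler0n.
apply/polyP => -[|k]; rewrite !(coefZ, coefB, mulrBl, mul1r) -!scalerAl !coefZ !coefXM /=.
  by rewrite !p_at0; ring.
have k_ne0 : (k%:R + 1) * (k%:R + b) != 0.
  by have k_ge0 := nat_ge0 k; rewrite mulf_neq0 // gt_eqF //; move: a_gt0 aE; lra.
apply: (mulfI k_ne0).
transitivity ((n.+1%:R + a) * ((k%:R + 1) * (k%:R + b) * (p n.+2)`_k.+1)); first by ring.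
rewrite coef_rankS.
transitivity ((2 * n.+1%:R + a) * ((k%:R + 1) * (k%:R + b) * (p n.+1)`_k.+1 -
   2 * ((k%:R + 1) * (k%:R + b) * (p n.+1)`_k))
  - (n%:R + 1) * ((k%:R + 1) * (k%:R + b) * (p n)`_k.+1)).
  (* Every term is now a multiple of the [k]-th coefficient of the middle polynomial [p n.+1]; the
     multipliers agree once a = 2 b - 1. *)
  rewrite coefS coef_rank_pred aE -[n.+1]addn1 natrD; ring.
by rewrite -[n.+1]addn1 natrD; ring.
Qed.

End GegenbauerCoefficients.

(** * Coefficient relations for the types A, B and D *)

Section Coefficients.

Variable R : realFieldType.

Lemma coef_fA l k :
  (fA R l)`_k = (-1) ^+ k * (1 / (l + 2)%:R) * 'C(l, k)%:R * 'C(l + k + 2, k + 1)%:R.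
Proof. by apply: coef_poly_bin => lk; rewrite bin_small // mulr0 mul0r. Qed.

Lemma coef_fB l k : (fB R l)`_k = (-1) ^+ k * 'C(l, k)%:R * 'C(l + k, k)%:R.
Proof. by apply: coef_poly_bin => lk; rewrite bin_small // mulr0 mul0r. Qed.

Lemma coef_fD l k : (1 < l)%N ->
  (fD R l)`_k = (-1) ^+ k * ('C(l, k)%:R * 'C(l + k - 1, k)%:R
    + (if (k < 2)%N then 0 else 'C(l - 2, k - 2)%:R) * 'C(l + k - 2, k)%:R).
Proof.
move=> l_gt1; apply: coef_poly_bin => lk.
rewrite bin_small // mul0r add0r ltnNge (leq_trans l_gt1) ?(ltnW lk) //=.
by rewrite bin_small ?mul0r ?mulr0 // ltn_sub2r // (leq_ltn_trans _ lk).
Qed.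

(** [fA R n] is 2F1(-n, n + 3; 2; t): the Gegenbauer polynomial of parameter 3/2 in 1 - 2 t, with
    value 1 at t = 0. *)
Lemma fA_rec n :
  (n.+1%:R + 3) *: fA R n.+2
  = (2 * n.+1%:R + 3) *: ((1 - 2 *: 'X) * fA R n.+1) - n.+1%:R *: fA R n.
Proof.
apply: (@gegenbauer_rec _ (fA R) 3 2) => // [|n' |n' k|n' k].
- by ring.
- rewrite coef_fA bin0 addn0 bin1 expr0 mulr1 mul1r mul1r mulVf //.
- rewrite !coef_fA exprS !addnS !addn0.
  have e1 := natr_bin_left R n' k; have e2 := natr_bin_diag R (n' + k).+2 k.+1.
  have -> : (k%:R + 1 : R) = k.+1%:R by rewrite natr1.
  have -> : (k%:R + 2 : R) = k.+2%:R by rewrite -natrD addn2.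
  transitivity (- ((-1) ^+ k * (1 / n'.+2%:R) * (k.+1%:R * 'C(n', k.+1)%:R) *
    (k.+2%:R * 'C((n' + k).+3, k.+2)%:R)) : R); first by ring.
  rewrite e1 e2.
  have -> : ((n' + k).+3%:R : R) = n'%:R + 3 + k%:R by rewrite -addn3 !natrD; ring.
  ring.
- rewrite !coef_fA !addnS !addn0 !addSn.
  have e1 := natr_bin_down R n' k.
  have e2 := natr_bin_down R (n' + k).+2 k.+1.
  have nz : n'%:R + 2 != 0 :> R by rewrite -natrD addn2 pnatr_eq0.
  have nz' : n'%:R + 3 != 0 :> R by rewrite -natrD addn3 pnatr_eq0.
  have E2 : n'.+2%:R = n'%:R + 2 :> R by rewrite -natrD addn2.
  have E3 : n'.+3%:R = n'%:R + 3 :> R by rewrite -natrD addn3.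
  rewrite E2 E3.
  have d2 : (n' + k).+3%:R = n'%:R + 3 + k%:R :> R by rewrite -addn3 !natrD addrAC.
  have d1 : n'%:R + 3 + k%:R - k.+1%:R = n'%:R + 2 :> R by rewrite -natr1; ring.
  rewrite d2 d1 in e2.
  rewrite -natr1 in e1.
  apply: (mulfI nz).
  transitivity ((-1) ^+ k * ((n'%:R + 1 - k%:R) * 'C(n'.+1, k)%:R) *
    ((n'%:R + 2) * 'C((n' + k).+3, k.+1)%:R) : R); first by field.
  by rewrite e1 e2; field.
Qed.

Lemma fB_ratio n k :
  (k%:R + 1) * (k%:R + 1) * (fB R n)`_k.+1
  = - (n%:R - k%:R) * (n%:R + 1 + k%:R) * (fB R n)`_k.
Proof.
rewrite !coef_fB exprS !addnS.
have e1 := natr_bin_left R n k; have e2 := natr_bin_diag R (n + k) k.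
rewrite natr1.
transitivity (- ((-1) ^+ k * (k.+1%:R * 'C(n, k.+1)%:R) *
    (k.+1%:R * 'C((n + k).+1, k.+1)%:R)) : R); first by ring.
rewrite e1 e2 -[in X in - X]natr1 natrD; ring.
Qed.

Lemma fB_rankS n k :
  (n%:R + 1 - k%:R) * (n%:R + 1) * (fB R n.+1)`_k
  = (n%:R + 1) * (n%:R + 1 + k%:R) * (fB R n)`_k.
Proof.
rewrite !coef_fB !addSn.
have e1 := natr_bin_down R n k.
have e2 := natr_bin_down R (n + k) k.
rewrite -!natr1 natrD in e1 e2.
transitivity ((-1) ^+ k * ((n%:R + 1 - k%:R) * 'C(n.+1, k)%:R) *
    ((n%:R + k%:R + 1 - k%:R) * 'C((n + k).+1, k)%:R) : R); first by ring.
by rewrite e1 e2; ring.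
Qed.

(** [fB R n] is 2F1(-n, n + 1; 1; t), the Legendre polynomial in 1 - 2 t. *)
Lemma fB_rec n :
  (n.+1%:R + 1) *: fB R n.+2
  = (2 * n.+1%:R + 1) *: ((1 - 2 *: 'X) * fB R n.+1) - n.+1%:R *: fB R n.
Proof.
apply: (@gegenbauer_rec _ (fB R) 1 1) => // [|n'||]; first by ring.
- by rewrite coef_fB !bin0 !mulr1.
- exact: fB_ratio.
- exact: fB_rankS.
Qed.

Lemma coef_fD_fB n k :
  (k%:R + 1) * (k%:R + 1) * (fD R n.+2)`_k.+1
  = - ((n%:R + 2) * (n%:R + 2 + k%:R) + k%:R * (k%:R + 1)) * (fB R n.+1)`_k.
Proof.
rewrite coef_fD // coef_fB exprS !addSn !addnS !subSS !subn0.
(* At k = 0 the factor k on the right vanishes, which takes care of the convention for negative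
   lower indices. *)
have -> : (if (k.+1 < 2)%N then 0 else 'C(n, k - 1)%:R)
    = k%:R / (n%:R + 1) * 'C(n.+1, k)%:R :> R.
  have nz : n%:R + 1 != 0 :> R by rewrite natr1 pnatr_eq0.
  case: k => [|k] /=; first by rewrite mul0r mul0r.
  rewrite subn1 /= mulrAC natr_bin_diag -natr1.
  by field.
have e1 := natr_bin_diag R n.+1 k.
have e2 := natr_bin_diag R (n + k).+1 k.
have e3 := natr_bin_left R (n + k).+1 k.
have nz : n%:R + 1 != 0 :> R by rewrite natr1 pnatr_eq0.
rewrite natr1.
transitivity (- ((-1) ^+ k * ((k.+1%:R * 'C(n.+2, k.+1)%:R) *
    (k.+1%:R * 'C((n + k).+2, k.+1)%:R) + k%:R * k.+1%:R / (n%:R + 1) * 'C(n.+1, k)%:R *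
    (k.+1%:R * 'C((n + k).+1, k.+1)%:R))) : R); first by ring.
rewrite e1 e2 e3.
have -> : (n + k).+2%:R = n%:R + k%:R + 2 :> R by rewrite -addn2 !natrD.
have -> : n.+2%:R = n%:R + 2 :> R by rewrite -addn2 !natrD.
rewrite -!natr1 natrD.
by field.
Qed.

(** Here l = n + 2. After multiplication by (n + 1) (k + 1)^2 the coefficient of index k + 1 of each
    term is a multiple of the [k]-th coefficient of [fB R n.+1]. *)
Lemma fD_fB n :
  (2 * n.+2%:R) *: fD R n.+2
  = (3 * n%:R + 4) *: ((1 - 2 *: 'X) * fB R n.+1) - n%:R *: fB R n.
Proof.
apply/polyP => k; rewrite mulrBl mul1r -(scalerAl 2 'X) !(coefB, coefZ, coefXM).
case: k => [|k] /=.
  rewrite coef_fD // !coef_fB !bin0 /= -[n.+2]addn2 natrD; ring.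
have k_ne0 : (k%:R + 1) * (k%:R + 1) != 0 :> R by rewrite natr1 mulf_neq0 // pnatr_eq0.
have n_ne0 : n%:R + 1 != 0 :> R by rewrite natr1 pnatr_eq0.
apply: (mulfI k_ne0); apply: (mulfI n_ne0).
have e1 := coef_fD_fB n k.
have e2 := fB_ratio n.+1 k.
have e3 := coef_rank_pred fB_ratio fB_rankS n k.
transitivity ((n%:R + 1) * (2 * n.+2%:R)
  * ((k%:R + 1) * (k%:R + 1) * (fD R n.+2)`_k.+1)); first by ring.
rewrite e1.
transitivity ((n%:R + 1) * (3 * n%:R + 4) * ((k%:R + 1) * (k%:R + 1) * (fB R n.+1)`_k.+1
   - 2 * ((k%:R + 1) * (k%:R + 1) * (fB R n.+1)`_k)) -
   n%:R * ((n%:R + 1) * ((k%:R + 1) * (k%:R + 1) * (fB R n)`_k.+1))).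
  by rewrite e2 e3 -[n.+2]addn2 -natr1 natrD; ring.
by ring.
Qed.

End Coefficients.

(** * Zeros in (0, 1), interlacing, and positivity of recurrences *)

Section Interlacing.

Variable R : realType.
Implicit Types (p g : {poly R}) (n : nat) (v w : nat -> R).

(* The zeros are [v 1 < ... < v n]; the end points of the interval are put at
   the indices [0] and [n.+1]. *)
Definition zeros p n v :=
  [/\ v 0%N = 0, v n.+1 = 1, forall i, (i <= n)%N -> v i < v i.+1
    & forall i, (i < n)%N -> root p (v i.+1)].

Definition interlaced n v w :=
  forall i, (i <= n)%N -> v i < w i.+1 < v i.+1.

Lemma zeros_lt p n v i j : zeros p n v -> (i < j <= n.+1)%N -> v i < v j.
Proof.
move=> [_ _ vlt _] /andP[]; elim: j => // j IHj.
rewrite ltnS leq_eqVlt => /predU1P[-> | ij] jn; first exact: vlt.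
by rewrite (lt_trans (IHj ij (ltnW jn))) // vlt.
Qed.

Lemma zeros_in01 p n v i : zeros p n v -> (i < n)%N -> 0 < v i.+1 < 1.
Proof.
move=> zv i_n; have [v0 v1 _ _] := zv.
apply/andP; split; [rewrite -v0 | rewrite -v1]; apply: (zeros_lt zv); lia.
Qed.

Definition zero_seq n v := [seq v i.+1 | i <- iota 0 n].

(** The [n] points are distinct roots of a nonzero polynomial of degree at most [n], so they exhaust
    its roots and the degree is exactly [n]. *)
Lemma zeros_factor p n v : (size p <= n.+1)%N -> p != 0 -> zeros p n v ->
  uniq (zero_seq n v) /\
  p = lead_coef p *: \prod_(z <- zero_seq n v) ('X - z%:P).
Proof.
move=> sz_p p_neq0 zv.
have us : uniq (zero_seq n v).
  rewrite map_inj_in_uniq ?iota_uniq // => i j.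
  rewrite !mem_iota !add0n /= => i_n j_n e.
  case: (ltngtP i j) => // ij; [have := zeros_lt zv (i := i.+1) (j := j.+1)
    | have := zeros_lt zv (i := j.+1) (j := i.+1)];
    by rewrite ltnS ij ltnS ltnW // e ltxx => /(_ isT).
have rs : all (root p) (zero_seq n v).
  apply/allP => _ /mapP[i + ->]; rewrite mem_iota add0n => i_n.
  by case: zv => _ _ _; exact.
split=> //; apply: all_roots_prod_XsubC; rewrite ?uniq_rootsE //.
apply/eqP; rewrite eqn_leq (leq_trans sz_p) ?size_map ?size_iota //=.
by have := max_poly_roots p_neq0 rs us; rewrite size_map size_iota.
Qed.

(** The factorization over [R] is carried along [f]; for the embedding into [R[i]] this excludes
    nonreal and multiple roots. *)
Lemma zeros_map_simple (F : fieldType) (f : {rmorphism R -> F}) p n v z :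
  (size p <= n.+1)%N -> p != 0 -> zeros p n v -> root (map_poly f p) z ->
  simple_root (map_poly f p) z /\ exists2 i, (i < n)%N & z = f (v i.+1).
Proof.
move=> sz_p p_neq0 zv; have [us pE] := zeros_factor sz_p p_neq0 zv.
have lc_neq0 : f (lead_coef p) != 0 by rewrite fmorph_eq0 lead_coef_eq0.
have pfE : map_poly f p
    = f (lead_coef p) *: \prod_(y <- map f (zero_seq n v)) ('X - y%:P).
  rewrite {1}pE map_polyZ rmorph_prod big_map; congr (_ *: _).
  by apply: eq_bigr => y _; rewrite rmorphB /= map_polyX map_polyC.
rewrite /simple_root pfE rootZ // root_prod_XsubC => z_rs.
split; last first.
  have /mapP[x /mapP[i + ->] ->] := z_rs; rewrite mem_iota add0n => i_n.
  by exists i.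
split=> //; rewrite -mul_polyC mupMr ?rootC // mu_prod_XsubC count_uniq_mem ?z_rs //.
by rewrite map_inj_uniq //; exact: fmorph_inj.
Qed.

Lemma zeros_real_simple p n v : (size p <= n.+1)%N -> p != 0 -> zeros p n v ->
  roots_real_simple_in01 p.
Proof.
move=> sz_p p_neq0 zv pC z pz.
have [zs [i i_n zE]] := zeros_map_simple (f := real_complex R) sz_p p_neq0 zv pz.
by split=> //; exists (v i.+1); split; rewrite // (zeros_in01 zv).
Qed.

Lemma zeros_smallest p n v : (0 < n)%N -> (size p <= n.+1)%N -> p != 0 ->
  zeros p n v -> smallest_root p (v 1%N).
Proof.
move=> n_gt0 sz_p p_neq0 zv; have [_ _ _ rv] := zv.
split=> [|y]; first exact: rv.
have [_ ->] := zeros_factor sz_p p_neq0 zv.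
rewrite rootZ ?lead_coef_eq0 // root_prod_XsubC => /mapP[[|i] + ->] //.
by rewrite mem_iota => i_n; apply/ltW/(zeros_lt zv); lia.
Qed.

(* Every root lying to the left of [t] contributes a factor [-1] to the sign of
   [p t * p 0]. *)
Lemma zeros_sign p n v i t : (size p <= n.+1)%N -> 0 < p.[0] -> zeros p n v ->
  (i <= n)%N -> v i < t < v i.+1 -> 0 < (-1) ^+ i * p.[t].
Proof.
move=> sz_p p0_gt0 zv i_n /andP[vi_t t_vi].
have p_neq0 : p != 0 by apply: contraTneq p0_gt0 => ->; rewrite horner0 ltxx.
have [_ pE] := zeros_factor sz_p p_neq0 zv.
have hE x : p.[x] = lead_coef p * \prod_(0 <= j < n) (x - v j.+1).
  rewrite {1}pE hornerZ horner_prod big_map /index_iota subn0; congr (_ * _).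
  by apply: eq_bigr => j _; rewrite hornerXsubC.
have iE : (-1) ^+ i = \prod_(0 <= j < n) (-1) ^+ (j < i)%N :> R.
  rewrite (big_cat_nat _ i_n) //= -[LHS]mulr1; congr (_ * _).
    rewrite (eq_big_nat _ _ (F2 := fun=> -1)) => [|j /andP[_ ->]]; last by rewrite expr1.
    by rewrite prodr_const_nat subn0.
  by rewrite big_nat big1 // => j /andP[ij _]; rewrite ltnNge ij expr0.
(* Multiplying by [p.[0]] makes the leading coefficient appear squared; what remains is a product of
   positive factors. *)
rewrite -(pmulr_lgt0 _ p0_gt0) !hE iE.
rewrite [ltRHS](_ : _ = lead_coef p ^+ 2 *
    \prod_(0 <= j < n) ((-1) ^+ (j < i)%N * (t - v j.+1) * (0 - v j.+1))); last first.
  by rewrite !big_split /=; ring.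
rewrite mulr_gt0 // ?exprn_even_gt0 ?lead_coef_eq0 ?orbT //.
rewrite big_nat; apply: prodr_gt0 => j /andP[_ j_n].
have /andP[vj_gt0 _] := zeros_in01 zv j_n.
case: ltnP => ij; rewrite ?expr1 ?expr0.
  have : v j.+1 <= v i.
    by move: ij; rewrite leq_eqVlt => /predU1P[-> //|ij]; apply/ltW/(zeros_lt zv); lia.
  by nra.
have : v i.+1 <= v j.+1.
  move: ij; rewrite leq_eqVlt => /predU1P[-> //|ij].
  by apply/ltW/(zeros_lt zv); lia.
by nra.
Qed.

(** The values of [g] at consecutive points, end points included, have opposite signs, so each gap
    contains a zero by the intermediate value theorem. *)
Lemma zeros_interlaced g p n v : zeros p n v ->
  (forall i, (i <= n.+1)%N -> 0 < (-1) ^+ i * g.[v i]) ->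
  exists w, zeros g n.+1 w /\ interlaced n v w.
Proof.
move=> [v0 v1 vlt _] sg.
have ivt i : exists x, (i <= n)%N -> v i < x < v i.+1 /\ root g x.
  case: (leqP i n) => [i_n|_]; last by exists 0.
  have : g.[v i] * g.[v i.+1] < 0.
    have h1 := sg _ (leqW i_n); have := sg i.+1 i_n; rewrite exprS.
    move=> /(mulr_gt0 h1); set s := (-1) ^+ i.
    rewrite [ltRHS](_ : _ = - (s ^+ 2) * (g.[v i] * g.[v i.+1])); last by ring.
    by rewrite sqrr_sign mulN1r oppr_gt0.
  move=> /(poly_ivtoo (ltW (vlt _ i_n)))[x]; rewrite in_itv /= => vx gx.
  by exists x.
have [u uP] := choice ivt.
(* The shift makes room for the end point 0; the arbitrary value [u n.+1] is replaced by the end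
   point 1. *)
pose w i := if i is j.+1 then if j == n.+1 then 1 else u j else 0.
have wE j : (j <= n)%N -> w j.+1 = u j.
  by move=> j_n; rewrite /w ltn_eqF.
exists w; split; last by move=> i i_n; rewrite wE //; exact: (uP _ _).1.
split=> // [|i|i i_n]; first by rewrite /w eqxx.
- case: i => [_|i i_n].
    by rewrite wE // {1}/w -v0; have [/andP[]] := uP 0%N isT.
  rewrite wE //; have [/andP[_ lt1] _] := uP i i_n; apply: (lt_le_trans lt1).
  move: i_n; rewrite ltnS leq_eqVlt => /predU1P[->|i_n].
    by rewrite v1 /w eqxx.
  by rewrite wE //; have [/andP[/ltW]] := uP i.+1 i_n.
- by rewrite wE //; exact: (uP _ _).2.
Qed.

(** At a zero of [q] one has [g] = - c [p], and interlacing gives [p] the sign (-1)^i at [w i.+1];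
    hence the signs of [g] alternate. Since [L] is arbitrary, this serves both the recurrence and
    the relation between D and B. *)
Lemma zeros_three_term (p q g L : {poly R}) (c : R) n v w :
  (size p <= n.+1)%N -> 0 < p.[0] -> zeros p n v -> interlaced n v w ->
  zeros q n.+1 w -> 0 < c -> g = L * q - c *: p -> 0 < g.[0] -> 0 < (-1) ^+ n * g.[1] ->
  exists w', zeros g n.+2 w' /\ interlaced n.+1 w w'.
Proof.
move=> sz_p p0 zv vw zw c_gt0 gE g0 g1.
apply: (zeros_interlaced zw) => -[_|i].
  by have [-> _ _ _] := zw; rewrite mul1r.
rewrite ltnS leq_eqVlt => /predU1P[->|i_n].
  by have [_ -> _ _] := zw; rewrite !exprS !mulN1r opprK.
have := zeros_sign sz_p p0 zv i_n (vw _ i_n).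
have [_ _ _ /(_ i i_n)/rootP qw] := zw.
rewrite gE hornerD hornerM qw mulr0 hornerN hornerZ add0r exprS.
by move=> /(mulr_gt0 c_gt0); congr (_ < _); ring.
Qed.

(* Otherwise the ratios [y n.+1 / y n] would eventually decrease by at least
   [1 - x] at each step. *)
Lemma three_term_not_gt0 (a x : R) (y : nat -> R) : 0 < a -> 0 <= x < 1 ->
  (forall n, (n.+1%:R + a) * y n.+2
     = (2 * n.+1%:R + a) * x * y n.+1 - n.+1%:R * y n) ->
  ~ (forall n, 0 < y n).
Proof.
move=> a_gt0 /andP[x_ge0 x_lt1] rec y_gt0.
pose r n := y n.+1 / y n.
have r_gt0 n : 0 < r n by rewrite divr_gt0.
have rS n : (n.+1%:R + a) * r n.+1 * r n = (2 * n.+1%:R + a) * x * r n - n.+1%:R.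
  have y0 := lt0r_neq0 (y_gt0 n); have y1 := lt0r_neq0 (y_gt0 n.+1).
  rewrite /r; transitivity (((n.+1%:R + a) * y n.+2) / y n).
    by field; rewrite y0 y1.
  by rewrite rec; field.
(* From this index on, 2 a < (n + 1) (1 - x). *)
pose N := Num.truncn (2 * a / (1 - x)).
have decr n : (N <= n)%N -> r n.+1 <= r n - (1 - x).
  move=> N_n; have n_big : 2 * a < n.+1%:R * (1 - x).
    rewrite -ltr_pdivrMr ?subr_gt0 //; apply: (lt_le_trans (truncnS_gt _)).
    by rewrite ler_nat ltnS.
  set m : R := n.+1%:R in n_big *; have m_gt0 : 0 < m by rewrite ltr0n.
  have ma_gt0 : 0 < m + a by rewrite addr_gt0.
  rewrite -(ler_pM2l ma_gt0) -(ler_pM2r (r_gt0 n)) rS -/m.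
  have := r_gt0 n; set s := r n => s_gt0.
  (* The right side minus the left side of the goal is the sum of the four nonnegative terms in [h1]
     to [h4]. *)
  have h1 : 0 <= m * (s - 1) ^+ 2 by rewrite mulr_ge0 ?sqr_ge0 // ltW.
  have h2 : 0 <= s * (m * (1 - x) - 2 * a) by rewrite mulr_ge0 ?subr_ge0 // ltW.
  have h3 : 0 <= a * s ^+ 2 by rewrite mulr_ge0 ?sqr_ge0 // ltW.
  have h4 : 0 <= a * s by rewrite mulr_ge0 // ltW.
  by nra.
have bound k : r (N + k)%N <= r N - k%:R * (1 - x).
  elim: k => [|k IHk]; first by rewrite addn0 mul0r subr0.
  rewrite addnS (le_trans (decr _ _)) ?leq_addr // -natr1.
  by move: IHk; lra.
(* With this many steps the bound on [r (N + k)] is negative. *)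
pose k := (Num.truncn (r N / (1 - x))).+1.
have := truncnS_gt (r N / (1 - x)); rewrite -/k ltr_pdivrMr ?subr_gt0 // => k_big.
by have := bound k; have := r_gt0 (N + k)%N; lra.
Qed.

Lemma decreasing_cvg0 (s : nat -> R) k :
  (forall l m, (k <= l)%N -> (l < m)%N -> s m < s l) ->
  (forall l, (k <= l)%N -> 0 < s l) ->
  (forall e, 0 < e -> exists2 l, (k <= l)%N & s l < e) ->
  s @ \oo --> (0 : R).
Proof.
move=> s_decr s_gt0 s_small; apply/cvgrPdist_lt => e e_gt0.
have [l k_l sl] := s_small _ e_gt0.
near=> m; have l_m : (l < m)%N by near: m; exact: nbhs_infty_gt.
rewrite sub0r normrN gtr0_norm ?s_gt0 ?(leq_trans k_l) ?(ltnW l_m) //.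
exact: lt_trans (s_decr _ _ k_l l_m) sl.
Unshelve. all: by end_near. Qed.

End Interlacing.

(** * From zeros to the behaviour of the smallest root *)

Section SmallestRoot.

Variable R : realType.

Lemma smallest_root_uniq (p : {poly R}) (x y : R) :
  smallest_root p x -> smallest_root p y -> x = y.
Proof. by move=> [px xP] [py yP]; apply: le_anti; rewrite xP //= yP. Qed.

Lemma root_before (p : {poly R}) (t : R) : 0 < t -> 0 < p.[0] -> p.[t] <= 0 ->
  exists2 x, root p x & x <= t.
Proof.
move=> t_gt0 p0; rewrite le_eqVlt => /predU1P[pt0|pt].
  by exists t => //; apply/rootP.
have /(poly_ivtoo (ltW t_gt0))[x] : p.[0] * p.[t] < 0 by rewrite pmulr_rlt0.
by rewrite in_itv /= => /andP[_ /ltW xt] px; exists x.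
Qed.

(** The conclusion shared by all three series. Any root of [q l.+1] below the smallest root of [q l]
    gives monotonicity, after which one small root per [e] suffices for the limit. *)
Lemma smallest_roots_cvg0 (q : nat -> {poly R}) (k : nat) : (0 < k)%N ->
  (forall l, (size (q l) <= l.+1)%N) -> (forall l, q l != 0) ->
  (forall l, (k <= l)%N -> exists v, zeros (q l) l v) ->
  (forall l x, (k <= l)%N -> smallest_root (q l) x ->
     exists2 y, root (q l.+1) y & y < x) ->
  (forall e : R, 0 < e -> exists2 l, (k <= l)%N & exists2 x, root (q l) x & x < e) ->
  (forall l, (k <= l)%N -> roots_real_simple_in01 (q l)) /\
  (forall l, (k <= l)%N -> exists x : R, smallest_root (q l) x) /\
  (forall s : nat -> R,
     (forall l, (k <= l)%N -> smallest_root (q l) (s l)) ->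
     (forall l m : nat, (k <= l)%N -> (l < m)%N -> s m < s l) /\
     s @ \oo --> (0 : R)).
Proof.
move=> k_gt0 sz_q q_neq0 q_zeros q_decr q_small.
have first_zero l v : (k <= l)%N -> zeros (q l) l v -> smallest_root (q l) (v 1%N).
  by move=> k_l; apply: zeros_smallest => //; exact: leq_trans k_l.
split=> [l /q_zeros[v]|]; first exact: zeros_real_simple.
split=> [l k_l|s sP].
  by have [v /first_zero vP] := q_zeros _ k_l; exists (v 1%N); exact: vP.
have s_decr l m : (k <= l)%N -> (l < m)%N -> s m < s l.
  move=> k_l; elim: m => // m IHm; rewrite ltnS => l_m.
  have k_m := leq_trans k_l l_m.
  have [y qy ym] := q_decr _ _ k_m (sP _ k_m).
  have [_ /(_ _ qy) sy] := sP _ (leqW k_m).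
  apply: (le_lt_trans sy); apply: (lt_le_trans ym).
  by move: l_m; rewrite leq_eqVlt => /predU1P[-> //|/IHm/ltW].
split=> //; apply: (@decreasing_cvg0 _ s k) => // [l k_l|e /q_small[l k_l [x qx xe]]].
  have [v zv] := q_zeros _ k_l.
  rewrite (smallest_root_uniq (sP _ k_l) (first_zero _ _ k_l zv)).
  by have /andP[] := zeros_in01 zv (leq_trans k_gt0 k_l).
by exists l => //; apply: le_lt_trans xe; have [_ ->] := sP _ k_l.
Qed.

End SmallestRoot.

(** * Zeros of polynomials satisfying the recurrence *)

Section GegenbauerZeros.

Variables (R : realType) (p : nat -> {poly R}) (a : R).
Hypothesis a_gt0 : 0 < a.
Hypothesis sz_p : forall n, (size (p n) <= n.+1)%N.
Hypotheses (p0E : p 0%N = 1) (p1E : p 1%N = 1 - 2 *: 'X).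
Hypothesis p_at0 : forall n, (p n).[0] = 1.
Hypothesis p_rec : forall n,
  (n.+1%:R + a) *: p n.+2
  = (2 * n.+1%:R + a) *: ((1 - 2 *: 'X) * p n.+1) - n.+1%:R *: p n.

Let na_gt0 n : 0 < n.+1%:R + a.
Proof. by rewrite addr_gt0 // ltr0Sn. Qed.

Lemma gegenbauer_neq0 n : p n != 0.
Proof.
by apply/eqP => pn0; have /eqP := p_at0 n; rewrite pn0 horner0 eq_sym oner_eq0.
Qed.

Lemma gegenbauer_rec_at n x :
  (n.+1%:R + a) * (p n.+2).[x]
  = (2 * n.+1%:R + a) * (1 - 2 * x) * (p n.+1).[x] - n.+1%:R * (p n).[x].
Proof.
have := congr1 (horner^~ x) (p_rec n).
by rewrite !hornerE.
Qed.

Lemma gegenbauer_at1 n : (p n).[1] = (-1) ^+ n.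
Proof.
suff [] : (p n).[1] = (-1) ^+ n /\ (p n.+1).[1] = (-1) ^+ n.+1 by [].
elim: n => [|n [IH0 IH1]].
  by rewrite p0E p1E !hornerE; split=> //; ring.
split=> //; apply: (mulfI (lt0r_neq0 (na_gt0 n))).
by rewrite gegenbauer_rec_at IH0 IH1 !exprS; ring.
Qed.

Lemma gegenbauer_interlaced n : exists v w,
  [/\ zeros (p n) n v, zeros (p n.+1) n.+1 w & interlaced n v w].
Proof.
elim: n => [|n [v [w [zv zw vw]]]].
  (* [p 0] has no zeros: only the end points 0 and 1 are listed, and the signs of [p 1] there start
     the induction. *)
  pose v (i : nat) : R := if i is 0%N then 0 else 1.
  have zv : zeros (p 0%N) 0 v by split=> // -[|//] _; exact: ltr01.
  have [|w [zw vw]] := zeros_interlaced (g := p 1%N) zv; last by exists v, w.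
  by case=> [|[|//]] _; rewrite /= ?p_at0 ?gegenbauer_at1 ?expr1 ?mulrNN mulr1 ltr01.
have g1 m : 0 < (-1) ^+ m * (p m.+2).[1].
  rewrite gegenbauer_at1 !exprS mulN1r mulN1r opprK -expr2.
  by rewrite exprn_even_gt0 // signr_eq0 orbT.
have n0 := lt0r_neq0 (na_gt0 n).
have [|||||w' [zw' ww']] := @zeros_three_term R (p n) (p n.+1) (p n.+2)
   (((2 * n.+1%:R + a) / (n.+1%:R + a)) *: (1 - 2 *: 'X))
   (n.+1%:R / (n.+1%:R + a)) n v w (sz_p n) _ zv vw zw; last by exists w, w'.
- by rewrite p_at0.
- by rewrite divr_gt0 // ltr0Sn.
- rewrite -scalerAl -[LHS](scalerK n0) p_rec scalerBr !scalerA.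
  by congr (_ *: _ - _ *: _); rewrite mulrC.
- by rewrite p_at0.
- exact: g1.
Qed.

Lemma gegenbauer_zeros n : exists v, zeros (p n) n v.
Proof. by have [v [w []]] := gegenbauer_interlaced n; exists v. Qed.

Lemma gegenbauer_root_lt n x : root (p n.+1) x -> exists2 y, root (p n.+2) y & y < x.
Proof.
move=> px; have [v [w [zv zw vw]]] := gegenbauer_interlaced n.+1.
have [_ _ _ /(_ 0%N isT) wr] := zw; exists (w 1%N) => //.
have /andP[_ w1v] := vw 0%N isT; apply: (lt_le_trans w1v).
by have [_ ->] := zeros_smallest (ltn0Sn _) (sz_p n.+1) (gegenbauer_neq0 _) zv.
Qed.

Lemma gegenbauer_small_root k (e : R) : 0 < e ->
  exists2 n, (k <= n)%N & exists2 x, root (p n.+1) x & x < e.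
Proof.
move=> e_gt0.
have [n [x px xe]] : exists n, exists2 x, root (p n.+1) x & x < e.
  (* Besides [t < e], the choice ensures 0 <= 1 - 2 t < 1, so not all values at [t] can be
     positive. *)
  pose t := Num.min (e / 2) (1 / 2).
  have t_gt0 : 0 < t by rewrite lt_min !divr_gt0.
  have te : t < e by rewrite gt_min ltr_pdivrMr // mulr_natr mulr2n ltrDl e_gt0.
  have t_le : t <= 1 / 2 by rewrite ge_min lexx orbT.
  have x01 : 0 <= 1 - 2 * t < 1 by apply/andP; split; lra.
  have /existsNP[n] := three_term_not_gt0 a_gt0 x01 (fun n => gegenbauer_rec_at n t).
  move=> /negP; rewrite -leNgt; case: n => [|n].
    by rewrite p0E hornerE ler10.
  move=> /(root_before t_gt0)[|x px xt]; first by rewrite p_at0.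
  by exists n, x => //; exact: le_lt_trans te.
(* Raising the rank only produces smaller roots, so the index can be pushed beyond [k]. *)
exists (n + k)%N; first exact: leq_addl.
elim: k => [|k [y /gegenbauer_root_lt[z pz zy] ye]]; first by rewrite addn0; exists x.
by rewrite addnS; exists z => //; exact: lt_trans ye.
Qed.

Lemma gegenbauer_smallest_roots_cvg0 k : (0 < k)%N ->
  (forall l, (k <= l)%N -> roots_real_simple_in01 (p l)) /\
  (forall l, (k <= l)%N -> exists x : R, smallest_root (p l) x) /\
  (forall s : nat -> R,
     (forall l, (k <= l)%N -> smallest_root (p l) (s l)) ->
     (forall l m : nat, (k <= l)%N -> (l < m)%N -> s m < s l) /\
     s @ \oo --> (0 : R)).
Proof.
move=> k_gt0; apply: smallest_roots_cvg0 => //.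
- exact: gegenbauer_neq0.
- by move=> l _; exact: gegenbauer_zeros.
- by move=> [|l] x k_l [px _]; [move: k_gt0; rewrite leqn0 in k_l; rewrite (eqP k_l)
    | exact: gegenbauer_root_lt].
- by move=> e /(gegenbauer_small_root k)[l k_l lP]; exists l.+1; rewrite // leqW.
Qed.

End GegenbauerZeros.

(** * Initial values, and the zeros in type D *)

Section ClusterPolynomials.

Variable R : realType.

Lemma poly_two_coef (q : {poly R}) (x y : R) : (size q <= 2)%N ->
  q`_0 = x -> q`_1 = y -> q = x%:P + y *: 'X.
Proof.
move=> sz_q q0 q1; apply/polyP => -[|[|k]]; rewrite coefD coefC coefZ coefX /=.
- by rewrite q0 mulr0 addr0.
- by rewrite q1 mulr1 add0r.
- by rewrite nth_default ?(leq_trans sz_q) // mulr0 addr0.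
Qed.

Lemma size_fA l : (size (fA R l) <= l.+1)%N. Proof. exact: size_poly. Qed.
Lemma size_fB l : (size (fB R l) <= l.+1)%N. Proof. exact: size_poly. Qed.
Lemma size_fD l : (size (fD R l) <= l.+1)%N. Proof. exact: size_poly. Qed.

Lemma fA_at0 l : (fA R l).[0] = 1.
Proof.
rewrite horner_coef0 coef_fA bin0 addn0 addn1 addn2 bin1 expr0 mulr1 mul1r mul1r mulVf //.
Qed.

Lemma fB_at0 l : (fB R l).[0] = 1.
Proof. by rewrite horner_coef0 coef_fB !bin0 !mulr1. Qed.

Lemma fD_at0 l : (fD R l).[0] = 1.
Proof.
by rewrite horner_coef0 coef_poly /= !bin0 mul0r addr0 !mulr1.
Qed.

Lemma fA0 : fA R 0 = 1.
Proof.
by rewrite [LHS]size1_polyC ?size_fA // -horner_coef0 fA_at0.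
Qed.

Lemma fB0 : fB R 0 = 1.
Proof.
by rewrite [LHS]size1_polyC ?size_fB // -horner_coef0 fB_at0.
Qed.

Lemma fA1 : fA R 1 = 1 - 2 *: 'X.
Proof.
rewrite [LHS](@poly_two_coef _ 1 (-2)) ?size_fA -?horner_coef0 ?fA_at0 ?scaleNr //.
rewrite coef_fA (_ : 'C(1, 1) = 1%N) // (_ : 'C(1 + 1 + 2, 1 + 1) = 6) //.
by field.
Qed.

Lemma fB1 : fB R 1 = 1 - 2 *: 'X.
Proof.
rewrite [LHS](@poly_two_coef _ 1 (-2)) ?size_fB -?horner_coef0 ?fB_at0 ?scaleNr //.
by rewrite coef_fB (_ : 'C(1, 1) = 1%N) // (_ : 'C(1 + 1, 1) = 2) //; ring.
Qed.

Lemma fD_fB_at n x :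
  2 * n.+2%:R * (fD R n.+2).[x]
  = (3 * n%:R + 4) * (1 - 2 * x) * (fB R n.+1).[x] - n%:R * (fB R n).[x].
Proof.
have := congr1 (horner^~ x) (fD_fB R n).
by rewrite !hornerE.
Qed.

Let fB_rec_at := gegenbauer_rec_at (@fB_rec R).
Let fB_at1 := gegenbauer_at1 (ltr01 : 0 < 1 :> R) fB0 fB1 (@fB_rec R).

Lemma fD_at1 n : (fD R n.+2).[1] = (-1) ^+ n.
Proof.
have n_neq0 : 2 * n.+2%:R != 0 :> R by rewrite mulf_neq0 // pnatr_eq0.
by apply: (mulfI n_neq0); rewrite fD_fB_at !fB_at1 exprS -addn2 natrD; ring.
Qed.

(** [fD R n.+2] takes the place of [fB R n.+2] in the interlacing step; n > 0 makes the coefficient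
    n / (2 (n + 2)) of [fB R n] positive. *)
Lemma fD_interlaced n : (0 < n)%N -> exists w w',
  [/\ zeros (fB R n.+1) n.+1 w, zeros (fD R n.+2) n.+2 w' & interlaced n.+1 w w'].
Proof.
move=> n_gt0.
have [v [w [zv zw vw]]] := gegenbauer_interlaced (ltr01 : 0 < 1 :> R)
  size_fB fB0 fB1 fB_at0 (@fB_rec R) n.
have c0 : 0 < 2 * n.+2%:R :> R by rewrite mulr_gt0 // ltr0Sn.
have [|||||w' [zw' ww']] := @zeros_three_term R (fB R n) (fB R n.+1) (fD R n.+2)
   (((3 * n%:R + 4) / (2 * n.+2%:R)) *: (1 - 2 *: 'X))
   (n%:R / (2 * n.+2%:R)) n v w (size_fB n) _ zv vw zw; last by exists w, w'.
- by rewrite fB_at0.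
- by rewrite divr_gt0 // ltr0n.
- rewrite -scalerAl -[LHS](scalerK (lt0r_neq0 c0)) fD_fB scalerBr !scalerA.
  by congr (_ *: _ - _ *: _); rewrite mulrC.
- by rewrite fD_at0.
- by rewrite fD_at1 -expr2 exprn_even_gt0 // signr_eq0 orbT.
Qed.

Lemma fD_neq0 l : fD R l != 0.
Proof.
by apply/eqP => q0; have /eqP := fD_at0 l; rewrite q0 horner0 eq_sym oner_eq0.
Qed.

(* At a zero [x < w 1] of [fD n.+2] one has [0 < fB n.+1], and eliminating
   [fB n] and [fB n.+2] makes [fD n.+3] a negative multiple of [fB n.+1]. *)
Lemma fD_smallest_root_lt n x : (0 < n)%N -> smallest_root (fD R n.+2) x ->
  exists2 y, root (fD R n.+3) y & y < x.
Proof.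
move=> n_gt0 xP; have [w [w' [zw zw' ww']]] := fD_interlaced n_gt0.
have xE := smallest_root_uniq xP (zeros_smallest (ltn0Sn _) (size_fD _) (fD_neq0 _) zw').
have [w0 _ _ _] := zw.
have /andP[x_gt0 xw] : 0 < x < w 1%N by rewrite xE -w0 ww'.
have : 0 < (fB R n.+1).[x].
  have := zeros_sign (i := 0) (t := x) (size_fB n.+1) _ zw isT.
  by rewrite fB_at0 mul1r w0 x_gt0 xw => /(_ ltr01 isT).
have xr : (fD R n.+2).[x] = 0 by apply/rootP; case: xP.
have := fD_fB_at n x; have := fB_rec_at n x; have := fD_fB_at n.+1 x.
rewrite xr.
set b := (fB R n).[x]; set b' := (fB R n.+1).[x]; set b'' := (fB R n.+2).[x].
set q := fD R n.+3; set d := q.[x]; set y := 1 - 2 * x.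
rewrite -(addn3 n) -(addn2 n) -(addn1 n) !natrD; set m : R := n%:R => e1 e2 e3 b'_gt0.
have m_gt0 : 0 < m by rewrite ltr0n.
have mb : m * b = (3 * m + 4) * y * b'.
  by move/esym/eqP: e3; rewrite mulr0 subr_eq0 => /eqP.
have eb'' : m * b'' = - (m + 2) * y * b'.
  have m2 : m + 2 != 0 by rewrite gt_eqF // addr_gt0.
  apply: (mulfI m2); transitivity (m * ((m + 1 + 1) * b'')); first by ring.
  rewrite e2; transitivity ((2 * (m + 1) + 1) * m * y * b' - (m + 1) * (m * b)).
    by ring.
  by rewrite mb; ring.
(* Only the square of y = 1 - 2 x remains, so the sign of [d] does not depend on that of [y]. *)
have ed : m * (2 * (m + 3) * d)
    = - (((3 * m + 7) * (m + 2) * y ^+ 2 + m * (m + 1)) * b').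
  rewrite e1; transitivity ((3 * m + 7) * y * (m * b'') - m * (m + 1) * b').
    by ring.
  by rewrite eb''; ring.
have d_lt0 : d < 0.
  have c_gt0 : 0 < m * (2 * (m + 3)) by rewrite !mulr_gt0 // addr_gt0.
  rewrite -(pmulr_rlt0 _ c_gt0) -mulrA ed oppr_lt0 mulr_gt0 //.
  have m1_gt0 : 0 < m * (m + 1) by rewrite mulr_gt0 // addr_gt0.
  have m2_gt0 : 0 < (3 * m + 7) * (m + 2) by rewrite mulr_gt0 ?addr_gt0 ?mulr_gt0.
  by rewrite (lt_le_trans m1_gt0) // lerDr mulr_ge0 ?sqr_ge0 // ltW.
have [|z rz zx] := root_before (p := q) x_gt0 _ (ltW d_lt0); first by rewrite fD_at0.
exists z => //; rewrite lt_neqAle zx andbT; apply: contraTneq rz => ->.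
by rewrite /root -/d lt_eqF.
Qed.

(** The first zero of [fD R n.+2] lies below that of [fB R n.+1], which type B makes arbitrarily
    small; n >= 2 gives rank at least 4. *)
Lemma fD_small_root (e : R) : 0 < e ->
  exists2 l, (4 <= l)%N & exists2 x, root (fD R l) x & x < e.
Proof.
move=> /(gegenbauer_small_root (ltr01 : 0 < 1 :> R) size_fB fB0 fB1 fB_at0 (@fB_rec R) 2).
move=> [n n_ge2 [x bx xe]]; exists n.+2 => //.
have [w [w' [zw zw' ww']]] := fD_interlaced (ltnW n_ge2).
have [_ _ _ /(_ 0%N isT) wr] := zw'; exists (w' 1%N) => //.
have /andP[_ w1v] := ww' 0%N isT; apply: (lt_trans _ xe); apply: (lt_le_trans w1v).
have fB_neq0 := gegenbauer_neq0 fB_at0.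
by have [_ ->] := zeros_smallest (ltn0Sn _) (size_fB n.+1) (fB_neq0 _) zw.
Qed.

End ClusterPolynomials.

Theorem theorem6p1 (R : realType) (P : series_type) :
  (forall l : nat, (min_rank P <= l)%N ->
     roots_real_simple_in01 (fpoly R P l)) /\
  (forall l : nat, (min_rank P <= l)%N ->
     exists x : R, smallest_root (fpoly R P l) x) /\
  (forall s : nat -> R,
     (forall l : nat, (min_rank P <= l)%N -> smallest_root (fpoly R P l) (s l)) ->
     (forall l m : nat, (min_rank P <= l)%N -> (l < m)%N -> s m < s l) /\
     s @ \oo --> (0 : R)).
Proof.
case: P => /=.
- apply: (@gegenbauer_smallest_roots_cvg0 R (fA R) 3) => //.
  + exact: size_fA.
  + exact: fA0.
  + exact: fA1.
  + exact: fA_at0.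
  + exact: fA_rec.
- apply: (@gegenbauer_smallest_roots_cvg0 R (fB R) 1) => //.
  + exact: size_fB.
  + exact: fB0.
  + exact: fB1.
  + exact: fB_at0.
  + exact: fB_rec.
- apply: (@smallest_roots_cvg0 R (fD R) 4) => //.
  + exact: size_fD.
  + exact: fD_neq0.
  (* Rank l + 3 is [n.+2] with n = l + 1, which is positive as [fD_interlaced] requires. *)
  + move=> [|[|[|l]]] // _.
    by have [w [w' [_ zw' _]]] := fD_interlaced R (ltn0Sn l); exists w'.
  + by move=> [|[|[|l]]] // x _; exact: fD_smallest_root_lt.
  + exact: fD_small_root.
Qed.
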